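(* An oracle that solves the generalized modHomSP for $(S_B,S_A)$ and the HomSP for $S_A$ is sufficient to break key establishment Protocol 2.
   Context: Let $L$ be a set with non-empty families $O_A,O_B$ of binary operations such that $x*_\alpha(y*_\beta z)=(x*_\alpha y)*_\beta(x*_\alpha z)$ and $x*_\beta(y*_\alpha z)=(x*_\beta y)*_\alpha(x*_\beta z)$ for all $x,y,z\in L$, $*_\alpha\in O_A$, $*_\beta\in O_B$. For a family $O$ of operations, $\langle y_1,\ldots,y_k\rangle_O$ is the smallest subset of $L$ containing $y_1,\ldots,y_k$ and closed under all operations in $O$. For $x=(x_1,\ldots,x_k)\in L^k$ and a vector of operations $o=( *_1,\ldots,*_k)$ put $\phi_{(x,o)}(y)=x_k*_k(x_{k-1}*_{k-1}\cdots(x_2*_2(x_1*_1y))\cdots)$. Protocol 2: public elements $s_1,\ldots,s_m,t_1,\ldots,t_n\in L$ are given, $S_A=\langle s_1,\ldots,s_m\rangle_{O_A}$, $S_B=\langle t_1,\ldots,t_n\rangle_{O_B}$. Alice's secret key is $(a_0,a,o_A)\in S_A\times L^{k_A}\times O_A^{k_A}$, Bob's is $(b,o_B)\in S_B^{k_B}\times O_B^{k_B}$ (with secret $k_A,k_B\ge1$). Put $\alpha=\phi_{(a,o_A)}$, $\beta=\phi_{(b,o_B)}$. Alice publishes $t_i'=\alpha(t_i)$ ($i\le n$) and $p_0=\alpha(a_0)$; Bob publishes $s_j'=\beta(s_j)$ ($j\le m$). The shared key is $K=\alpha(\beta(a_0))$. Breaking the protocol means finding $K$ from the public data $s_j,s_j',t_i,t_i',p_0$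 (the attacker can evaluate the operations in $O_A\cup O_B$). HomSP (Homomorphism Search Problem) for $S_A$: given pairs $(s_1,s_1'),\ldots,(s_m,s_m')\in L^2$ for which there are unknown $k_B$, $b\in L^{k_B}$ and $o_B\in O_B^{k_B}$ with $s_i'=\phi_{(b,o_B)}(s_i)$ for all $i\le m$, find $k_B'\in\mathbb{N}$, $b'\in L^{k_B'}$ and $o_B'\in O_B^{k_B'}$, defining a magma homomorphism $\phi_{(b',o_B')}:S_A\to(L,O_A)$, such that $\phi_{(b',o_B')}(s_i)=s_i'$ for all $i\le m$. Generalized modHomSP (modified Homomorphism Search Problem) for $(S_B,S_A)$: given pairs $(t_1,t_1'),\ldots,(t_n,t_n')\in L^2$ and $p_0\in L$ for which there are unknown $k_A$, $a\in L^{k_A}$, $o_A\in O_A^{k_A}$ and $a_0\in S_A$ with $t_i'=\phi_{(a,o_A)}(t_i)$ for all $i\le n$ and $p_0=\phi_{(a,o_A)}(a_0)$, find $k_A'\in\mathbb{N}$, $a_0'\in S_A$, $a'\in L^{k_A'}$ and $o_A'\in O_A^{k_A'}$, defining a magma homomorphism $\phi_{(a',o_A')}:S_B\to(L,O_B)$, such that $\phi_{(a',o_A')}(t_i)=t_i'$ for all $i\le n$ and $\phi_{(a',o_A')}(a_0')=p_0$. *)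

(* Defs.v *)
From mathcomp Require Import all_boot.

Set Implicit Arguments.
Unset Strict Implicit.
Unset Printing Implicit Defensive.

(* A family of binary operations on L is an indexed family
   op : I -> L -> L -> L, with x *_i y written op i x y. *)

Definition left_distributive_over (L I J : Type)
    (opI : I -> L -> L -> L) (opJ : J -> L -> L -> L) : Prop :=
  forall (i : I) (j : J) (x y z : L),
    opI i x (opJ j y z) = opJ j (opI i x y) (opI i x z).

Inductive generated (L I : Type) (op : I -> L -> L -> L)
    (k : nat) (y : k.-tuple L) : L -> Prop :=
| generated_gen (i : 'I_k) : generated op y (tnth y i)
| generated_op (i : I) (u v : L) :
    generated op y u -> generated op y v -> generated op y (op i u v).

(* An element (k, x, o) of the disjoint union over k of L^k * O^k. *)
Record key (L I : Type) : Type := Key {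
  klen : nat;
  kelts : klen.-tuple L;
  kops : klen.-tuple I }.

Definition key_pairs (L I : Type) (a : key L I) : seq (L * I) :=
  zip (kelts a) (kops a).

(* phi op (x, o) y = x_k *_k (x_(k-1) *_(k-1) ... (x_1 *_1 y)); foldl
   processes (x_1, *_1) first. *)
Definition phi (L I : Type) (op : I -> L -> L -> L) (a : key L I) (y : L) : L :=
  foldl (fun (u : L) (p : L * I) => op p.2 p.1 u) y (key_pairs a).

Definition homomorphism_on (L I : Type) (op : I -> L -> L -> L)
    (S : L -> Prop) (f : L -> L) : Prop :=
  forall (i : I) (u v : L), S u -> S v -> f (op i u v) = op i (f u) (f v).

(* The oracles are only constrained on the instances admitted by the
   problems, with the given generators of S_A and S_B.  Instances come from
   keys of positive length, as in the protocol; answers may have any length. *)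

Definition HomSP_instance (L IB : Type) (opB : IB -> L -> L -> L)
    (m : nat) (s s' : m.-tuple L) : Prop :=
  exists b : key L IB,
    0 < klen b /\ forall i : 'I_m, tnth s' i = phi opB b (tnth s i).

Definition HomSP_solution (L IA IB : Type)
    (opA : IA -> L -> L -> L) (opB : IB -> L -> L -> L)
    (m : nat) (s s' : m.-tuple L) (b' : key L IB) : Prop :=
  homomorphism_on opA (generated opA s) (phi opB b') /\
  forall i : 'I_m, phi opB b' (tnth s i) = tnth s' i.

Definition solves_HomSP (L IA IB : Type)
    (opA : IA -> L -> L -> L) (opB : IB -> L -> L -> L)
    (m : nat) (s : m.-tuple L) (oracle : seq (L * L) -> key L IB) : Prop :=
  forall s' : m.-tuple L, HomSP_instance opB s s' ->
    HomSP_solution opA opB s s' (oracle (zip s s')).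

Definition modHomSP_instance (L IA : Type) (opA : IA -> L -> L -> L)
    (m n : nat) (s : m.-tuple L) (t t' : n.-tuple L) (p0 : L) : Prop :=
  exists (a : key L IA) (a0 : L),
    [/\ 0 < klen a, generated opA s a0,
        forall i : 'I_n, tnth t' i = phi opA a (tnth t i)
      & p0 = phi opA a a0].

Definition modHomSP_solution (L IA IB : Type)
    (opA : IA -> L -> L -> L) (opB : IB -> L -> L -> L)
    (m n : nat) (s : m.-tuple L) (t t' : n.-tuple L) (p0 : L)
    (a0' : L) (a' : key L IA) : Prop :=
  [/\ generated opA s a0',
      homomorphism_on opB (generated opB t) (phi opA a'),
      forall i : 'I_n, phi opA a' (tnth t i) = tnth t' i
    & phi opA a' a0' = p0].

Definition solves_modHomSP (L IA IB : Type)
    (opA : IA -> L -> L -> L) (opB : IB -> L -> L -> L)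
    (m n : nat) (s : m.-tuple L) (t : n.-tuple L)
    (oracle : seq (L * L) -> L -> L * key L IA) : Prop :=
  forall (t' : n.-tuple L) (p0 : L), modHomSP_instance opA s t t' p0 ->
    modHomSP_solution opA opB s t t' p0
      (oracle (zip t t') p0).1 (oracle (zip t t') p0).2.

Record public_data (L : Type) (m n : nat) : Type := PublicData {
  pub_s : m.-tuple L;
  pub_s' : m.-tuple L;
  pub_t : n.-tuple L;
  pub_t' : n.-tuple L;
  pub_p0 : L }.

Definition protocol2_public (L IA IB : Type)
    (opA : IA -> L -> L -> L) (opB : IB -> L -> L -> L)
    (m n : nat) (s : m.-tuple L) (t : n.-tuple L)
    (a0 : L) (a : key L IA) (b : key L IB) : public_data L m n :=
  {| pub_s := s;
     pub_s' := [tuple of map (phi opB b) s];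
     pub_t := t;
     pub_t' := [tuple of map (phi opA a) t];
     pub_p0 := phi opA a a0 |}.

Definition protocol2_Alice_key (L IA : Type) (opA : IA -> L -> L -> L)
    (m : nat) (s : m.-tuple L) (a0 : L) (a : key L IA) : Prop :=
  generated opA s a0 /\ 0 < klen a.

Definition protocol2_Bob_key (L IB : Type) (opB : IB -> L -> L -> L)
    (n : nat) (t : n.-tuple L) (b : key L IB) : Prop :=
  0 < klen b /\ forall i : 'I_(klen b), generated opB t (tnth (kelts b) i).

Definition protocol2_shared_key (L IA IB : Type)
    (opA : IA -> L -> L -> L) (opB : IB -> L -> L -> L)
    (a0 : L) (a : key L IA) (b : key L IB) : L :=
  phi opA a (phi opB b a0).

(* Attackers are programs for a black-box oracle machine.  Programs are
   finite syntactic objects that cannot mention elements of L: the machine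
   obtains these only from the public data, by evaluating operations, and
   from oracle answers, so that an attack cannot be an arbitrary (possibly
   non-computable) function of the public data.  Loops range over arrays,
   whose lengths never exceed those of the public data, and over oracle
   answers, and neither grows: with oracle calls counted as single steps,
   every program runs in time polynomial in the lengths of the public data
   and of the oracle answers.

   I is the set of operation names, IA + IB below.  In the constructors,
   r ranges over element registers, f over operation registers, v over array
   registers and w over key registers. *)
Inductive command (I : Type) : Type :=
| Skip
| Seq (c1 c2 : command I)
| Move (r r1 : nat)
| SetOp (f : nat) (i : I)
| Eval (r f r1 r2 : nat)              (* r := r1 *_f r2 *)
| Copy (v v1 : nat)
| ForArray (v r : nat) (c : command I)
    (* for each entry x of v in order: r := x; run c; replace the entry by r *)
| ForKey (w r f : nat) (c : command I)
    (* for each pair (x_i, *_i) of w in order: r := x_i; f := *_i; run c *)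
| AskHomSP (w v1 v2 : nat)            (* w := answer on the pairs (v1, v2) *)
| AskModHomSP (w r v1 v2 r1 : nat).
    (* (r, w) := answer on the pairs (v1, v2) and the element r1 *)

Arguments Skip {I}.
Arguments Move {I}.
Arguments Eval {I}.
Arguments Copy {I}.
Arguments AskHomSP {I}.
Arguments AskModHomSP {I}.

Record state (L I : Type) : Type := State {
  elt_reg : nat -> L;
  op_reg : nat -> I;
  array_reg : nat -> seq L;
  key_reg : nat -> seq (L * I) }.

Definition upd (T : Type) (g : nat -> T) (k : nat) (x : T) : nat -> T :=
  fun j => if j == k then x else g j.

Definition set_elt (L I : Type) (st : state L I) (r : nat) (x : L) :=
  State (upd (elt_reg st) r x) (op_reg st) (array_reg st) (key_reg st).
Definition set_op (L I : Type) (st : state L I) (f : nat) (i : I) :=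
  State (elt_reg st) (upd (op_reg st) f i) (array_reg st) (key_reg st).
Definition set_array (L I : Type) (st : state L I) (v : nat) (s : seq L) :=
  State (elt_reg st) (op_reg st) (upd (array_reg st) v s) (key_reg st).
Definition set_key (L I : Type) (st : state L I) (w : nat) (a : seq (L * I)) :=
  State (elt_reg st) (op_reg st) (array_reg st) (upd (key_reg st) w a).

Fixpoint run (L I : Type) (op : I -> L -> L -> L)
    (hom : seq (L * L) -> seq (L * I))
    (modhom : seq (L * L) -> L -> L * seq (L * I))
    (c : command I) (st : state L I) {struct c} : state L I :=
  match c with
  | Skip => st
  | Seq c1 c2 => run op hom modhom c2 (run op hom modhom c1 st)
  | Move r r1 => set_elt st r (elt_reg st r1)
  | SetOp f i => set_op st f i
  | Eval r f r1 r2 =>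
      set_elt st r (op (op_reg st f) (elt_reg st r1) (elt_reg st r2))
  | Copy v v1 => set_array st v (array_reg st v1)
  | ForArray v r c1 =>
      let step (acc : state L I * seq L) (x : L) :=
        let st1 := run op hom modhom c1 (set_elt acc.1 r x) in
        (st1, rcons acc.2 (elt_reg st1 r)) in
      let res := foldl step (st, [::]) (array_reg st v) in
      set_array res.1 v res.2
  | ForKey w r f c1 =>
      foldl (fun (st1 : state L I) (p : L * I) =>
               run op hom modhom c1 (set_op (set_elt st1 r p.1) f p.2))
            st (key_reg st w)
  | AskHomSP w v1 v2 =>
      set_key st w (hom (zip (array_reg st v1) (array_reg st v2)))
  | AskModHomSP w r v1 v2 r1 =>
      let ans := modhom (zip (array_reg st v1) (array_reg st v2))
                        (elt_reg st r1) in
      set_key (set_elt st r ans.1) w ans.2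
  end.

Definition op_sum (L IA IB : Type)
    (opA : IA -> L -> L -> L) (opB : IB -> L -> L -> L)
    (i : IA + IB) : L -> L -> L :=
  match i with inl i => opA i | inr i => opB i end.

Definition rename_ops (L I J : Type) (g : I -> J) (a : seq (L * I)) :
    seq (L * J) :=
  map (fun p : L * I => (p.1, g p.2)) a.

(* Initially arrays 0, 1, 2, 3 hold s, s', t, t' and the others are empty,
   all element registers hold p_0, and all operation registers hold i0. *)
Definition initial_state (L I : Type) (i0 : I) (m n : nat)
    (pub : public_data L m n) : state L I :=
  {| elt_reg := fun=> pub_p0 pub;
     op_reg := fun=> i0;
     array_reg := fun v => match v with
       | 0 => pub_s pub
       | 1 => pub_s' pub
       | 2 => pub_t pub
       | 3 => pub_t' pub
       | _ => [::]
       end;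
     key_reg := fun=> [::] |}.

(* The output of an attack is the final content of element register 0. *)
Definition attack_output (L IA IB : Type)
    (opA : IA -> L -> L -> L) (opB : IB -> L -> L -> L)
    (homO : seq (L * L) -> key L IB)
    (modO : seq (L * L) -> L -> L * key L IA)
    (iA : IA) (m n : nat) (c : command (IA + IB)) (pub : public_data L m n) : L :=
  let hom ps := rename_ops (@inr IA IB) (key_pairs (homO ps)) in
  let modhom ps x :=
    ((modO ps x).1, rename_ops (@inl IA IB) (key_pairs (modO ps x).2)) in
  elt_reg (run (op_sum opA opB) hom modhom c (initial_state (inl iA) pub)) 0.

Definition breaks_protocol2 (L IA IB : Type)
    (opA : IA -> L -> L -> L) (opB : IB -> L -> L -> L)
    (m n : nat) (s : m.-tuple L) (t : n.-tuple L)
    (homO : seq (L * L) -> key L IB)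
    (modO : seq (L * L) -> L -> L * key L IA)
    (iA : IA) (c : command (IA + IB)) : Prop :=
  forall (a0 : L) (a : key L IA) (b : key L IB),
    protocol2_Alice_key opA s a0 a ->
    protocol2_Bob_key opB t b ->
    attack_output opA opB homO modO iA c
      (protocol2_public opA opB s t a0 a b) =
    protocol2_shared_key opA opB a0 a b.

(* Main.v *)
(* Mutual distributivity makes alpha and the oracle's alpha' endomorphisms of
   (L, O_B), and beta and the oracle's beta' endomorphisms of (L, O_A).  Hence
   alpha, alpha' agree on S_B and beta, beta' agree on S_A.  An endomorphism f
   of (L, O_B) satisfies f o phi_(b,o) = phi_(f(b),o) o f; since the entries of
   b lie in S_B and alpha a_0 = p_0 = alpha' a_0', this gives
   alpha (beta a_0) = alpha' (beta a_0') = alpha' (beta' a_0'). *)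
Require Import Defs.
From mathcomp Require Import all_boot.

Set Implicit Arguments.
Unset Strict Implicit.
Unset Printing Implicit Defensive.

(** [phi] composes left translations of [opI], each of which distributes over [opJ] on the whole of
    [L], so no membership in a generated subset is required. *)
Lemma phi_left_distributive (L I J : Type)
    (opI : I -> L -> L -> L) (opJ : J -> L -> L -> L) (a : key L I)
    (j : J) (u v : L) :
  left_distributive_over opI opJ ->
  phi opI a (opJ j u v) = opJ j (phi opI a u) (phi opI a v).
Proof.
move=> distr; rewrite /phi; elim: (key_pairs a) u v => //= p ps IHps u v.
by rewrite distr IHps.
Qed.

Definition map_key (L L' I : Type) (f : L -> L') (b : key L I) : key L' I :=
  Key (map_tuple f (kelts b)) (kops b).

Lemma phi_map_key (L I : Type) (op : I -> L -> L -> L) (f : L -> L)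
    (b : key L I) (y : L) :
  (forall i u v, f (op i u v) = op i (f u) (f v)) ->
  f (phi op b y) = phi op (map_key f b) (f y).
Proof.
move=> fM; rewrite /phi /key_pairs /=.
elim: (val (kelts b)) (val (kops b)) y => [|x xs IHxs] [|o os] y //=.
by rewrite IHxs fM.
Qed.

Lemma eq_map_key (L L' I : Type) (f g : L -> L') (b : key L I) :
  (forall i, f (tnth (kelts b) i) = g (tnth (kelts b) i)) ->
  map_key f b = map_key g b.
Proof.
move=> fg; rewrite /map_key; congr (Key _ _).
by apply: eq_from_tnth => i; rewrite !tnth_map.
Qed.

Lemma eq_on_generated (L I : Type) (op : I -> L -> L -> L) (k : nat)
    (y : k.-tuple L) (f g : L -> L) (x : L) :
  homomorphism_on op (generated op y) f ->
  homomorphism_on op (generated op y) g ->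
  (forall i, f (tnth y i) = g (tnth y i)) ->
  generated op y x -> f x = g x.
Proof.
move=> fM gM fg; elim=> [//|i u v Su fgu Sv fgv].
by rewrite fM // gM // fgu fgv.
Qed.

Lemma shared_key_eq (L IA IB : Type)
    (opA : IA -> L -> L -> L) (opB : IB -> L -> L -> L)
    (m n : nat) (s : m.-tuple L) (t : n.-tuple L)
    (a0 a0' : L) (a a' : key L IA) (b b' : key L IB) :
  left_distributive_over opA opB -> left_distributive_over opB opA ->
  protocol2_Bob_key opB t b -> generated opA s a0' ->
  (forall i, phi opA a' (tnth t i) = phi opA a (tnth t i)) ->
  (forall i, phi opB b' (tnth s i) = phi opB b (tnth s i)) ->
  phi opA a' a0' = phi opA a a0 ->
  phi opA a' (phi opB b' a0') = protocol2_shared_key opA opB a0 a b.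
Proof.
move=> distrAB distrBA [_ Sb] Sa0' eq_a eq_b eq_p0.
have phiAM c j u v := phi_left_distributive c j u v distrAB.
have phiBM c i u v := phi_left_distributive c i u v distrBA.
(* The entries of [b'] need not lie in S_B, so [b'] has to be exchanged for [b] before [phi opA a']
   is moved inside. *)
have -> : phi opB b' a0' = phi opB b a0'.
  by apply: (eq_on_generated _ _ eq_b Sa0') => i u v _ _; apply: phiBM.
(* Both sides now start from the same point p_0; only the keys [b] mapped by alpha' and by alpha
   remain to be compared. *)
rewrite /protocol2_shared_key !(phi_map_key b _ (phiAM _)) eq_p0.
congr (phi opB _ _); apply: eq_map_key => i.
by apply: (eq_on_generated _ _ eq_a (Sb i)) => j u v _ _; apply: phiAM.
Qed.

Definition apply_key (I : Type) (w : nat) : command I :=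
  ForKey w 1 0 (Eval 0 0 1 0).

(** [g] is the tagging [inl] or [inr] of the operations in an oracle answer. Preservation of the key
    registers lets a second key be applied afterwards. *)
Lemma run_apply_key (L I J : Type) (op : I -> L -> L -> L) hom modhom
    (g : J -> I) (w : nat) (a : key L J) (st : state L I) :
  key_reg st w = rename_ops g (key_pairs a) ->
  let st' := run op hom modhom (apply_key I w) st in
  elt_reg st' 0 = phi (fun j => op (g j)) a (elt_reg st 0) /\
  key_reg st' = key_reg st.
Proof.
move=> /= ->; rewrite /phi /rename_ops.
elim: (key_pairs a) st => [//|p ps IHps] st /=.
by case: (IHps (set_elt (set_op (set_elt st 1 p.1) 0 (g p.2)) 0
                        (op (g p.2) p.1 (elt_reg st 0)))).
Qed.

(** Element register 0 initially holds p_0, is overwritten by a_0', and then accumulates the result;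
    key register 1 holds beta', applied first, and key register 0 holds alpha'. *)
Definition protocol2_attack (I : Type) : command I :=
  Seq (AskModHomSP 0 0 2 3 0)
    (Seq (AskHomSP 1 0 1) (Seq (apply_key I 1) (apply_key I 0))).

Lemma protocol2_attack_output (L IA IB : Type)
    (opA : IA -> L -> L -> L) (opB : IB -> L -> L -> L)
    (homO : seq (L * L) -> key L IB)
    (modO : seq (L * L) -> L -> L * key L IA)
    (iA : IA) (m n : nat) (pub : public_data L m n) :
  let ans := modO (zip (pub_t pub) (pub_t' pub)) (pub_p0 pub) in
  attack_output opA opB homO modO iA (protocol2_attack (IA + IB)) pub =
  phi opA ans.2 (phi opB (homO (zip (pub_s pub) (pub_s' pub))) ans.1).
Proof.
rewrite /attack_output /protocol2_attack.
set hom := (X in run _ X); set modhom := (X in run _ _ X).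
set st0 := initial_state _ _.
(* The state after both oracle calls; regrouping the sequence gives a convertible run. *)
pose st1 := run (op_sum opA opB) hom modhom
  (Seq (AskModHomSP 0 0 2 3 0) (AskHomSP 1 0 1)) st0.
have [e1 k1] := @run_apply_key _ _ _ (op_sum opA opB) hom modhom inr 1
  (homO (zip (pub_s pub) (pub_s' pub))) st1 erefl.
set st2 := run _ _ _ _ st1 in e1 k1.
have k0 : key_reg st2 0 = rename_ops inl (key_pairs
    (modO (zip (pub_t pub) (pub_t' pub)) (pub_p0 pub)).2) by rewrite k1.
have [e2 _] := @run_apply_key _ _ _ (op_sum opA opB) hom modhom _ _ _ _ k0.
by rewrite e1 in e2.
Qed.

Theorem proposition4p5 (IA IB : Type) (iA : IA) (iB : IB) :
  exists attack : command (IA + IB),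
    forall (L : Type) (opA : IA -> L -> L -> L) (opB : IB -> L -> L -> L)
      (distrAB : left_distributive_over opA opB)
      (distrBA : left_distributive_over opB opA)
      (m n : nat) (s : m.-tuple L) (t : n.-tuple L)
      (homO : seq (L * L) -> key L IB)
      (modO : seq (L * L) -> L -> L * key L IA),
    solves_modHomSP opA opB s t modO ->
    solves_HomSP opA opB s homO ->
    breaks_protocol2 opA opB s t homO modO iA attack.
Proof.
exists (protocol2_attack (IA + IB)).
move=> L opA opB distrAB distrBA m n s t homO modO modP homP.
move=> a0 a b [Sa0 a_gt0] Bob_b; rewrite protocol2_attack_output /=.
(* The secret keys themselves witness that the public data are admissible oracle instances. *)
have [|Sa0' _ eq_a eq_p0] := modP [tuple of map (phi opA a) t] (phi opA a a0).
  by exists a, a0; split=> // i; rewrite tnth_map.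
have [|_ eq_b] := homP [tuple of map (phi opB b) s].
  by exists b; split=> [|i]; [case: Bob_b | rewrite tnth_map].
apply: (shared_key_eq distrAB distrBA Bob_b Sa0' _ _ eq_p0) => i.
  by rewrite eq_a tnth_map.
by rewrite eq_b tnth_map.
Qed.
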